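(* Let $X$ be a smooth complete toric variety with fan $\Sigma$, Cox ring $R=\mathbb{C}[x_1,\dots,x_r]$ and irrelevant ideal $B$. Let $I\subset R$ be a $B$-saturated monomial ideal with Klyachko diagram $\{(\mathcal{C}^\sigma_I,\Delta^\sigma_I)\}_{\sigma\in\Sigma}$. Then for any $\alpha\in\mathrm{Cl}(X)$, $$h_{R/I}(\alpha)=\left|\bigcup_{\sigma\in\Sigma_{\max}}\Big(\big(\Delta^\sigma_I(\overline\alpha)\cap\mathcal{C}_0(\overline\alpha)\big)\cup\big(\mathcal{C}_0(\overline\alpha)\setminus\mathcal{C}^\sigma_I(\overline\alpha)\big)\Big)\right| .$$
   Context: Setting. $X$ is an $n$-dimensional smooth complete toric variety over $\mathbb{C}$ with fan $\Sigma\subset N\otimes\mathbb{R}$, $N\cong\mathbb{Z}^n$, $M=\mathrm{Hom}(N,\mathbb{Z})$; $\Sigma_{\max}$ is the set of maximal cones. $\Sigma(1)=\{\rho_1,\dots,\rho_r\}$ is the ordered set of rays, $\sigma(1)$ the set of rays of a cone $\sigma$, $n(\rho)\in N$ is the first nonzero lattice point on $\rho$, and $\langle m,\rho\rangle:=\langle m,n(\rho)\rangle$. The Cox ring $R=\mathbb{C}[x_1,\dots,x_r]$ has one variable $x_i=x_{\rho_i}$ per ray and is graded by $\mathrm{Cl}(X)$ via $\deg x_i=[D_{\rho_i}]$. With $x^{\hat\sigma}=\prod_{\rho_i\notin\sigma(1)}x_i$, the irrelevant ideal is $B=\langle x^{\hat\sigma}\mid\sigma\in\Sigma\rangle$. An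 ideal $I$ is $B$-saturated if $H^0_B(I)=H^1_B(I)=0$, equivalently $I=(I:B^\infty)$. The Hilbert function is $h_{R/I}(\alpha)=\dim_{\mathbb{C}}(R/I)_\alpha$. Since $X$ is smooth and complete, after permuting variables $\mathrm{Cl}(X)$ is free with basis $[D_{\rho_1}],\dots,[D_{\rho_\ell}]$; for $\alpha=\sum_{i=1}^\ell\alpha_i[D_{\rho_i}]$ put $\overline\alpha:=(\alpha_1,\dots,\alpha_\ell,0,\dots,0)\in\mathbb{Z}^r$. Klyachko diagram. Let $I=(m_1,\dots,m_t)$, $t\ge1$, be generated by monomials $m_i$; $\deg_{\rho_j}$ of a monomial is its exponent in $x_j$. Put $s_j=s_{\rho_j}:=\min_i\deg_{\rho_j}(m_i)$. For $\sigma=\mathrm{cone}(\rho_{i_1},\dots,\rho_{i_c})$ of dimension $c$, put $\mathcal{C}^\sigma_I:=\{m\in M\mid\langle m,\rho_{i_p}\rangle\ge s_{i_p},\ 1\le p\le c\}$. For a subset $\mathcal{S}=\{n_1,\dots,n_s\}\subset\{m_1,\dots,m_t\}$ define $\Delta^\sigma_I(\mathcal{S})\subset\mathcal{C}^\sigma_I$ recursively: - $\Delta^\sigma_I(\emptyset):=\mathcal{C}^\sigma_I$. - If $s\ge1$ and $c=0$ (i.e. $\sigma=\{0\}$): $\Delta^\sigma_I(\mathcal{S}):=\emptyset$. - If $s\ge1$ and $c\geq 1$, order the elements so that $\deg_{\rho_{i_c}}(n_{1})\le\cdots\le\deg_{\rho_{i_c}}(n_{s})$. If $c=1$: $\Delta^\sigma_I(\mathcal{S}):=\{m\mid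 s_{i_1}\le\langle m,\rho_{i_1}\rangle<\deg_{\rho_{i_1}}(n_1)\}$. If $c\ge2$, put $\sigma'=\mathrm{cone}(\rho_{i_1},\dots,\rho_{i_{c-1}})$ and $\Delta^\sigma_I(\mathcal{S}):=\bigcup_{j=0}^s\Delta^\sigma_I(\mathcal{S})_j$, where $\Delta^\sigma_I(\mathcal{S})_0:=\{m\mid s_{i_c}\le\langle m,\rho_{i_c}\rangle<\deg_{\rho_{i_c}}(n_1)\}\cap\Delta^{\sigma'}_I(\emptyset)$, $\Delta^\sigma_I(\mathcal{S})_j:=\{m\mid\deg_{\rho_{i_c}}(n_j)\le\langle m,\rho_{i_c}\rangle<\deg_{\rho_{i_c}}(n_{j+1})\}\cap\Delta^{\sigma'}_I(\{n_1,\dots,n_j\})$ for $1\le j\le s-1$, $\Delta^\sigma_I(\mathcal{S})_s:=\{m\mid\deg_{\rho_{i_c}}(n_s)\le\langle m,\rho_{i_c}\rangle\}\cap\Delta^{\sigma'}_I(\{n_1,\dots,n_s\})$. Finally $\Delta^\sigma_I:=\Delta^\sigma_I(\{m_1,\dots,m_t\})$. The collection $\{(\mathcal{C}^\sigma_I,\Delta^\sigma_I)\}_{\sigma\in\Sigma}$ is the Klyachko diagram of $I$. Shifts. For $D=(a_\rho)\in\mathbb{Z}^r$ and $\sigma\in\Sigma$, choose $\tau_\sigma\in M$ with $\langle\tau_\sigma,\rho\rangle=a_\rho$ for all $\rho\in\sigma(1)$ (possible since $X$ is smooth). Then $\mathcal{C}^\sigma_I(D):=\mathcal{C}^\sigma_I-\tau_\sigma=\{m\in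 M\mid m+\tau_\sigma\in\mathcal{C}^\sigma_I\}$ and $\Delta^\sigma_I(D):=\Delta^\sigma_I-\tau_\sigma$. With $\mathcal{C}^\sigma_0:=\{m\in M\mid\langle m,\rho\rangle\ge0,\ \rho\in\sigma(1)\}$ and $\mathcal{C}^\sigma_0(D):=\mathcal{C}^\sigma_0-\tau_\sigma$, put $\mathcal{C}_0(D):=\bigcap_{\sigma\in\Sigma_{\max}}\mathcal{C}^\sigma_0(D)$. *)

(* Defs.v *)
From HB Require Import structures.
From mathcomp Require Import all_boot all_order all_algebra.
From mathcomp Require Import boolp classical_sets functions cardinality reals.
From mathcomp Require Import complex.
From mathcomp Require Import mpoly.

Set Implicit Arguments.
Unset Strict Implicit.
Unset Printing Implicit Defensive.

Import Order.TTheory GRing.Theory Num.Theory.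
Local Open Scope ring_scope.
Local Open Scope classical_set_scope.

(** * Fans

    N = Z^n is 'rV[int]_n and M = Hom(N, Z) is 'cV[int]_n, paired by the row by
    column product; N (x) R is 'rV[R]_n.  A normal toric variety is given by its
    fan, and it is smooth (resp. complete) when the fan is. *)

Section Cones.
Variables (R : realType) (n r : nat).

Definition real_vec (v : 'rV[int]_n) : 'rV[R]_n := map_mx intr v.

Definition cone_of (u : 'I_r -> 'rV[int]_n) (s : {set 'I_r}) : set 'rV[R]_n :=
  [set v | exists2 c : 'I_r -> R, forall i, 0 <= c i &
           v = \sum_(i in s) c i *: real_vec (u i)].

(* F is the intersection of the cone K with a supporting hyperplane (or K) *)
Definition face_of (F K : set 'rV[R]_n) : Prop :=
  exists2 m : 'cV[R]_n, forall v, K v -> 0 <= (v *m m) 0 0 &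
    F = K `&` [set v | (v *m m) 0 0 = 0].

End Cones.

Arguments cone_of R {n r} u s.

(* The rays are ordered by 'I_r and [ray i] is the first lattice point n(rho_i);
   a cone sigma is encoded by its set sigma(1) of rays. *)
Record fan (R : realType) (n r : nat) := Fan {
  ray : 'I_r -> 'rV[int]_n;
  cones : {set {set 'I_r}};
  ray_primitive : forall i (k : nat) v, ray i = v *+ k -> k = 1%N;
  ray_inj : injective ray;
  ray_cone : forall i, finset.set1 i \in cones;
  cones_neq0 : exists s, s \in cones;
  cone_pointed : forall s, s \in cones ->
    forall v, cone_of R ray s v -> cone_of R ray s (- v) -> v = 0;
  cone_rays : forall s, s \in cones -> forall i,
    i \in s <-> face_of (cone_of R ray (finset.set1 i)) (cone_of R ray s);
  cone_faces : forall s, s \in cones ->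
    forall F, face_of F (cone_of R ray s) ->
    exists2 t, t \in cones & F = cone_of R ray t;
  cone_inter : forall s t, s \in cones -> t \in cones ->
    face_of (cone_of R ray s `&` cone_of R ray t) (cone_of R ray s)
}.

Section Toric.
Variables (R : realType) (n r : nat) (X : fan R n r).

(* the ray generators of each cone are part of a Z-basis of N *)
Definition smooth_fan : Prop :=
  forall s, s \in cones X ->
  exists2 B : 'M[int]_n, B \in unitmx &
    exists2 f : 'I_r -> 'I_n, {in s &, injective f} &
      forall i, i \in s -> ray X i = row (f i) B.

Definition complete_fan : Prop :=
  forall v : 'rV[R]_n, exists2 s, s \in cones X & cone_of R (ray X) s v.

(* inclusion of cones of a fan is inclusion of their sets of rays *)
Definition max_cones : set {set 'I_r} :=
  [set s | maxset (mem (cones X)) s].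

Definition pairing (m : 'cV[int]_n) (i : 'I_r) : int := (ray X i *m m) 0 0.

(** * The class group

    A torus-invariant divisor sum_i D_i D_(rho_i) is the row D; Cl(X) is the
    cokernel of M -> Z^r, m |-> div(chi^m). *)

Definition divisor_of_char (m : 'cV[int]_n) : 'rV[int]_r := \row_i pairing m i.

Definition principal : {pred 'rV[int]_r} :=
  [pred D | `[< exists m, D = divisor_of_char m >]].

Lemma principal_zmod_closed : zmod_closed principal.
Proof.
split=> [|D E].
  rewrite unfold_in /=; apply/asboolP; exists (0 : 'cV_n).
  by apply/rowP => i; rewrite !mxE /pairing mulmx0 mxE.
rewrite !unfold_in /= => /asboolP [m ->] /asboolP [m' ->].
apply/asboolP; exists (m - m').
by apply/rowP => i; rewrite !mxE /pairing mulmxBr !mxE.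
Qed.

HB.instance Definition _ :=
  GRing.isZmodClosed.Build 'rV[int]_r principal principal_zmod_closed.

Definition Cl : zmodType := Quotient.quot principal.

Definition divisor_class (D : 'rV[int]_r) : Cl := (\pi_Cl D)%qT.

Definition ray_class (i : 'I_r) : Cl := divisor_class (delta_mx 0 i).

Definition class_of_coords (l : nat) (hl : (l <= r)%N) (a : 'rV[int]_l) : Cl :=
  \sum_(i < l) ray_class (widen_ord hl i) *~ a 0 i.

(* the classes of the first l rays form a Z-basis of Cl(X) *)
Definition class_basis (l : nat) (hl : (l <= r)%N) : Prop :=
  forall alpha : Cl, exists! a : 'rV[int]_l, alpha = class_of_coords hl a.

(* (a_1, ..., a_l) |-> (a_1, ..., a_l, 0, ..., 0) *)
Definition bar (l : nat) (hl : (l <= r)%N) (a : 'rV[int]_l) : 'rV[int]_r :=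
  \sum_(i < l) a 0 i *: delta_mx 0 (widen_ord hl i).

(** * Ideals of the Cox ring *)

Notation cox := {mpoly (complex R)[r]}.

Definition ideal_gen (G : set cox) : set cox :=
  [set f | exists2 gs : seq (cox * cox), forall g, g \in gs -> G g.2 &
           f = \sum_(g <- gs) g.1 * g.2].

Definition ideal_pow (J : set cox) (k : nat) : set cox :=
  ideal_gen [set f | exists2 g : 'I_k -> cox, forall j, J (g j) &
                     f = \prod_(j < k) g j].

Definition ideal_colon (I J : set cox) : set cox :=
  [set f | forall g, J g -> I (f * g)].

Definition irrelevant : set cox :=
  ideal_gen [set f | exists2 s, s \in cones X & f = \prod_(i | i \notin s) 'X_i].

Definition B_saturated (I : set cox) : Prop :=
  I = \bigcup_(k in [set: nat]) ideal_colon I (ideal_pow irrelevant k).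

Definition monomial_ideal (ms : seq 'X_{1..r}) : set cox :=
  ideal_gen [set f | exists2 m, m \in ms & f = 'X_[m]].

(** * The Hilbert function *)

Definition monomial_class (m : 'X_{1..r}) : Cl :=
  \sum_(i < r) ray_class i *+ m i.

Definition graded_piece (alpha : Cl) : set cox :=
  [set f | forall m, m \in msupp f -> monomial_class m = alpha].

(* d elements of W form a basis of W / (I `&` W) *)
Definition quotient_dim (W I : set cox) (d : nat) : Prop :=
  exists b : 'I_d -> cox,
    [/\ forall j, W (b j),
        forall c : 'I_d -> complex R,
          I (\sum_j c j *: b j) -> forall j, c j = 0
      & forall f, W f -> exists c : 'I_d -> complex R,
          I (f - \sum_j c j *: b j)].

(* 0 if (R/I)_alpha is infinite dimensional *)
Definition hilbert (I : set cox) (alpha : Cl) : nat :=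
  xget 0%N (quotient_dim (graded_piece alpha) I).

(** * The Klyachko diagram *)

(* s_j; the default value of the minimum is harmless when ms is nonempty *)
Definition min_deg (ms : seq 'X_{1..r}) (j : 'I_r) : nat :=
  \big[minn/head 0%MM ms j]_(m <- ms) m j.

Definition C_rays (ms : seq 'X_{1..r}) (rs : seq 'I_r) : set 'cV[int]_n :=
  [set m | forall i, i \in rs -> (min_deg ms i)%:Z <= pairing m i].

(* The list of rays is reversed: for sigma = cone(rho_(i_1), ..., rho_(i_c)) it is
   i_c, ..., i_1, so that its tail is sigma'.  With ns = n_1, ..., n_k sorted,
   n_j is nth 0 ns j.-1. *)
Fixpoint Delta_rays (ms : seq 'X_{1..r}) (rs : seq 'I_r)
    (S : seq 'X_{1..r}) {struct rs} : set 'cV[int]_n :=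
  if S is [::] then C_rays ms rs else
  match rs with
  | [::] => set0
  | i :: rs' =>
    let ns := sort (fun u v : 'X_{1..r} => (u i <= v i)%N) S in
    let k := size ns in
    let deg j : int := (nth 0%MM ns j.-1 i)%:Z in
    if rs' is [::] then
      [set m | (min_deg ms i)%:Z <= pairing m i < deg 1%N]
    else
      ([set m | (min_deg ms i)%:Z <= pairing m i < deg 1%N]
         `&` Delta_rays ms rs' [::])
      `|` \bigcup_(j in [set j | (1 <= j < k)%N])
            ([set m | deg j <= pairing m i < deg j.+1]
               `&` Delta_rays ms rs' (take j ns))
      `|` ([set m | deg k <= pairing m i] `&` Delta_rays ms rs' ns)
  end.

(* [enum s] lists the rays of s in increasing order *)
Definition C_diag (ms : seq 'X_{1..r}) (s : {set 'I_r}) : set 'cV[int]_n :=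
  C_rays ms (enum s).

Definition Delta_diag (ms : seq 'X_{1..r}) (s : {set 'I_r}) : set 'cV[int]_n :=
  Delta_rays ms (rev (enum s)) ms.

Definition C_zero (s : {set 'I_r}) : set 'cV[int]_n :=
  [set m | forall i, i \in s -> 0 <= pairing m i].

(* a choice of tau_sigma; it exists when the fan is smooth and s is a cone *)
Definition tau (D : 'rV[int]_r) (s : {set 'I_r}) : 'cV[int]_n :=
  xget 0 [set t | forall i, i \in s -> pairing t i = D 0 i].

(* A - tau_sigma *)
Definition shift (D : 'rV[int]_r) (s : {set 'I_r}) (A : set 'cV[int]_n) :
    set 'cV[int]_n :=
  [set m | A (m + tau D s)].

Definition C_zero_shift (D : 'rV[int]_r) : set 'cV[int]_n :=
  \bigcap_(s in max_cones) shift D s (C_zero s).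

End Toric.

Arguments monomial_ideal R {r} ms.

(* Main.v *)
Require Import Defs.
From HB Require Import structures.
From mathcomp Require Import all_boot all_order all_algebra.
From mathcomp Require Import boolp classical_sets functions cardinality reals.
From mathcomp Require Import complex.
From mathcomp Require Import mpoly.

(** Write P for the set of characters m with <m, rho_i> + D_i >= 0 for every
    ray, where D represents alpha.  Sending m to the exponent vector
    (<m, rho_i> + D_i)_i identifies P with the monomials of degree alpha
    ([monomial_class_exponent]), and completeness makes P finite
    ([finite_polytope]) and the identification injective ([pairing_inj]).  The
    monomials of degree alpha outside a monomial ideal I form a basis of
    (R/I)_alpha ([standard_monomials_basis]), so the theorem says that the union
    on the right is the set of those m in P whose monomial is not in I
    ([diagram_union_standard]).

    Unwinding the recursion shows that a set Delta^sigma consists of the points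
    m of C^sigma such that no generator g satisfies g_i <= <m, rho_i> on all the
    rays of sigma ([Delta_raysE]); outside C^sigma there is no such generator
    either.  Hence the term of sigma in the union collects the m in P whose
    monomial does not lie in I after the variables off sigma are inverted, and
    the union over the maximal cones collects the monomials that leave I in at
    least one affine chart.

    Saturation says that these are all the monomials outside I
    ([saturated_monomial_ideal]): if x^e lies in I on every maximal chart, a
    monomial in a product of many elements of B is divisible, by the pigeonhole
    principle, by a high power of one x^(hat sigma); this supplies the exponents
    off sigma that x^e lacks, so that x^e is in the colon ideal I : B^k.

    A smooth fan enters through the existence of the translations tau_sigma
    ([tau_spec]). *)

Set Implicit Arguments.
Unset Strict Implicit.
Unset Printing Implicit Defensive.

Import Order.TTheory GRing.Theory Num.Theory.
Local Open Scope ring_scope.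
Local Open Scope classical_set_scope.

(** * The sets Delta of the Klyachko diagram *)

(** Cutting the sorted list where its degrees exceed t leaves exactly the
    generators whose i-th exponent is at most t; the indices j of the union in
    the recursion for Delta are the possible places of this cut.  The two
    implications leave the ends j = 0 and j = size ns without a boundary
    condition. *)
Lemma has_sorted_cut (r : nat) (i : 'I_r) (t : int) (P : pred 'X_{1..r})
    (ns : seq 'X_{1..r}) (j : nat) :
  sorted (fun u v : 'X_{1..r} => (u i <= v i)%N) ns -> (j <= size ns)%N ->
  ((0 < j)%N -> (nth 0%MM ns j.-1 i)%:Z <= t) ->
  ((j < size ns)%N -> t < (nth 0%MM ns j i)%:Z) ->
  has (fun g : 'X_{1..r} => ((g i)%:Z <= t) && P g) ns = has P (take j ns).
Proof.
move=> ns_sorted le_j below above.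
have nth_le p q : (p <= q)%N -> (q < size ns)%N ->
    (nth 0%MM ns p i <= nth 0%MM ns q i)%N.
  move=> le_pq lt_q.
  apply: (sorted_leq_nth _ _ 0%MM ns_sorted) => //.
  - by move=> u v w /leq_trans; apply.
  - by rewrite inE (leq_ltn_trans le_pq).
rewrite -{1}(cat_take_drop j ns) has_cat.
have -> : has (fun g : 'X_{1..r} => ((g i)%:Z <= t) && P g) (drop j ns) = false.
  apply/negbTE/hasPn => g /(nthP 0%MM) [p]; rewrite size_drop nth_drop => lt_p <-.
  have lt_jp : (j + p < size ns)%N by rewrite -ltn_subRL.
  rewrite negb_and -ltNge (lt_le_trans (above _)) //.
    by rewrite (leq_ltn_trans _ lt_jp) ?leq_addr.
  by rewrite lez_nat nth_le ?leq_addr.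
rewrite orbF; apply: eq_in_has => g /(nthP 0%MM) [p].
rewrite size_take_min leq_min => /andP [lt_pj lt_p]; rewrite nth_take // => <-.
suff -> : (nth 0%MM ns p i)%:Z <= t by [].
have j_gt0 : (0 < j)%N by apply: leq_ltn_trans lt_pj.
apply: le_trans (below j_gt0); rewrite lez_nat; apply: nth_le.
  by rewrite -ltnS prednK.
by rewrite prednK.
Qed.

Lemma min_deg_le (r : nat) (ms : seq 'X_{1..r}) (i : 'I_r) (g : 'X_{1..r}) :
  g \in ms -> (min_deg ms i <= g i)%N.
Proof.
rewrite /min_deg; move: (head 0%MM ms) => d.
elim: ms => // h ms IH; rewrite inE big_cons geq_min => /orP [/eqP ->|/IH ->].
  by rewrite leqnn.
by rewrite orbT.
Qed.

Section Geometry.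
Variables (R : realType) (n r : nat) (X : fan R n r).
Implicit Types (m : 'cV[int]_n) (s : {set 'I_r}).

(** Delta is the part of the cone C where no generator of S has its monomial
    below m on the given rays.  In the recursion, fixing the piece that contains
    m selects the generators that are below m on the last ray, and the remaining
    rays are tested on these only. *)
Lemma Delta_raysE (ms : seq 'X_{1..r}) (rs : seq 'I_r) (S : seq 'X_{1..r}) m :
  {subset S <= ms} ->
  Delta_rays X ms rs S m <->
  C_rays X ms rs m /\
  ~~ has (fun g : 'X_{1..r} => all (fun i => (g i)%:Z <= pairing X m i) rs) S.
Proof.
elim: rs S => [|i rs IH] [|g0 S0] S_ms; try by split=> // -[].
set S := g0 :: S0 in S_ms *.
rewrite [X in X <-> _]/=.
set ns := sort _ _.
have mem_ns : ns =i S by apply: mem_sort.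
have k_gt0 : (0 < size ns)%N by rewrite size_sort.
have ns_ms j : (j < size ns)%N -> nth 0%MM ns j \in ms.
  by move=> lt_j; apply: S_ms; rewrite -mem_ns mem_nth.
have ns_sorted : sorted (fun u v : 'X_{1..r} => (u i <= v i)%N) ns.
  by apply: sort_sorted => u v; apply: leq_total.
set t := pairing X m i.
have C_cons : C_rays X ms (i :: rs) m <->
    (min_deg ms i)%:Z <= t /\ C_rays X ms rs m.
  split=> [C_m|[le_i C_m] i']; last by rewrite inE => /orP [/eqP ->|/C_m].
  by split=> [|i' i'_rs]; apply: C_m; rewrite inE ?eqxx // i'_rs orbT.
rewrite C_cons -(eq_has_r mem_ns) /=.
pose P (g : 'X_{1..r}) := all (fun i' => (g i')%:Z <= pairing X m i') rs.
have cut := @has_sorted_cut r i t P ns.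
have lt_deg1 : t < (nth 0%MM ns 0 i)%:Z ->
    has (fun g : 'X_{1..r} => ((g i)%:Z <= t) && P g) ns = false.
  by move=> lt_t; rewrite (cut 0%N) // take0.
have deg_min j : (j < size ns)%N -> (nth 0%MM ns j i)%:Z <= t ->
    (min_deg ms i)%:Z <= t.
  by move=> lt_j; apply: le_trans; rewrite lez_nat min_deg_le ?ns_ms.
have IH' ns' : {subset ns' <= ns} ->
  Delta_rays X ms rs ns' m <-> C_rays X ms rs m /\ ~~ has P ns'.
  by move=> sub; apply: IH => g /sub; rewrite mem_ns; apply: S_ms.
have IHtake j := IH' (take j ns) (@mem_take j _ ns).
have take_nil : take 0 ns = [::] by apply: take0.
have IH0 : Delta_rays X ms rs [::] m <-> C_rays X ms rs m.
  by rewrite -take_nil IHtake take0; split=> [[]|].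
have IHk := IH' ns (fun g => id).
case: rs => [|i' rs] in IH C_cons P cut lt_deg1 IH' IHtake IH0 IHk *.
  split=> [/andP [le_t /lt_deg1 no_g]|[[le_t _] no_g]].
    by split=> //; rewrite no_g.
  apply/andP; split=> //; rewrite ltNge; apply: contra no_g => le_deg.
  by apply/hasP; exists (nth 0%MM ns 0); rewrite ?mem_nth //= le_deg.
split=> [[[[/andP [le_t lt_t] D_m]|[j /= /andP [j_gt0 lt_j] [/andP [le_t lt_t] D_m]]]|
          [le_t D_m]]|[[le_t C_m] no_g]].
- by split; [split=> //; apply/IH0|rewrite lt_deg1].
- have [C_m no_g] := (IHtake j).1 D_m.
  split; last by rewrite (cut j) // ltnW.
  split=> //; apply: deg_min le_t; apply: leq_ltn_trans lt_j; exact: leq_pred.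
- have [C_m no_g] := IHk.1 D_m.
  have lt_k : ((size ns).-1 < size ns)%N by rewrite prednK.
  split; first by split=> //; apply: deg_min le_t.
  by rewrite (cut (size ns)) // ?ltnn // take_size.
(* The piece containing m is found from the first degree above t. *)
pose j := find (fun g : 'X_{1..r} => t < (g i)%:Z) ns.
have le_j : (j <= size ns)%N by apply: find_size.
have above : (j < size ns)%N -> t < (nth 0%MM ns j i)%:Z.
  by rewrite -has_find => /(nth_find 0%MM).
have below : (0 < j)%N -> (nth 0%MM ns j.-1 i)%:Z <= t.
  move=> j_gt0; rewrite leNgt.
  by rewrite (@before_find _ 0%MM (fun g : 'X_{1..r} => t < (g i)%:Z)) // prednK.
rewrite (cut j) // in no_g.
have [j0|j_gt0] := posnP j.
  by left; left; split; [rewrite j0 in above; rewrite /= le_t above|apply/IH0].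
move: le_j; rewrite leq_eqVlt => /orP [/eqP j_eq|lt_j].
  right; split; first by rewrite -j_eq; apply: below.
  by apply/IHk; split=> //; rewrite j_eq take_size in no_g.
left; right; exists j; first by rewrite /= j_gt0 lt_j.
by split; [rewrite /= below // above|apply/IHtake].
Qed.

(** The two ways in which the cone s contributes to the union amount to one
    condition: outside C, some coordinate of m is below all the generators. *)
Lemma in_C_or_Delta (ms : seq 'X_{1..r}) s m :
  Delta_diag X ms s m \/ ~ C_diag X ms s m <->
  ~~ has (fun g : 'X_{1..r} => [forall i in s, (g i)%:Z <= pairing X m i]) ms.
Proof.
have all_s (g : 'X_{1..r}) : all (fun i => (g i)%:Z <= pairing X m i) (rev (enum s))
    = [forall i in s, (g i)%:Z <= pairing X m i].
  rewrite all_rev; apply/allP/forall_inP => all_le i i_s; apply: all_le.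
    by rewrite mem_enum.
  by rewrite mem_enum in i_s.
have C_rev : C_rays X ms (rev (enum s)) m <-> C_diag X ms s m.
  by split=> C_m i i_s; apply: C_m; move: i_s; rewrite mem_rev.
rewrite /Delta_diag Delta_raysE // C_rev (eq_has all_s).
split=> [[[]|not_C]|no_g] //; last by case: (EM (C_diag X ms s m)); [left|right].
apply/hasPn => g g_ms; apply/negP => /forall_inP le_g; apply: not_C => i.
rewrite mem_enum => i_s; apply: le_trans (le_g i i_s).
by rewrite lez_nat min_deg_le.
Qed.

(** * Smooth and complete fans *)

Lemma pairingD m m' i : pairing X (m + m') i = pairing X m i + pairing X m' i.
Proof. by rewrite /pairing mulmxDr mxE. Qed.

(** The rays of s are among the rows of an invertible integer matrix B, so the
    equations defining tau are solved by applying its inverse to a column with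
    prescribed entries. *)
Lemma tau_spec (D : 'rV[int]_r) s : smooth_fan X -> s \in cones X ->
  forall i, i \in s -> pairing X (tau X D s) i = D 0 i.
Proof.
move=> Xsmooth s_cone.
suff: exists t, forall i, i \in s -> pairing X t i = D 0 i by move/(xgetPex 0).
have [B B_unit [f f_inj rayE]] := Xsmooth s s_cone.
exists (invmx B *m \col_k \sum_(i in s | f i == k) D 0 i) => i i_s.
rewrite /pairing rayE // -row_mul mulKVmx // !mxE (bigD1 i) ?i_s ?eqxx //=.
rewrite big1 ?addr0 // => j /andP [/andP [j_s /eqP fj]] /negP [].
by apply/eqP/f_inj.
Qed.

Lemma max_cone_cones s : s \in max_cones X -> s \in cones X.
Proof. by rewrite inE => /maxsetp. Qed.

Lemma sub_max_cone s : s \in cones X -> exists2 s', s' \in max_cones X & s \subset s'.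
Proof. by move=> /maxset_exists [s' max_s' sub]; exists s'; rewrite ?inE. Qed.

(** Every ray lies on a maximal cone, so the local conditions put together give
    one inequality for each ray: this is the polytope of the divisor D. *)
Lemma C_zero_shiftE (D : 'rV[int]_r) m : smooth_fan X ->
  C_zero_shift X D m <-> forall i, 0 <= pairing X m i + D 0 i.
Proof.
move=> Xsmooth; split=> [C_m i|pos_m s /mem_set s_max i i_s].
  have [s s_max] := sub_max_cone (ray_cone X i).
  rewrite finset.sub1set => i_s; have := C_m s (set_mem s_max) i i_s.
  rewrite pairingD tau_spec //.
  exact: max_cone_cones.
have := pos_m i; rewrite pairingD tau_spec //.
exact: max_cone_cones.
Qed.

(** The form in which completeness is used: any real linear form on M is a
    nonnegative combination of the pairings with the rays, so that bounds on the
    pairings give bounds on the coordinates. *)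
Lemma rays_positively_span (v : 'rV[R]_n) : complete_fan X ->
  exists2 c : 'I_r -> R, forall i, 0 <= c i &
    forall m, (v *m map_mx intr m) 0 0 = \sum_i c i * (pairing X m i)%:~R.
Proof.
move=> /(_ v) [s _ [c c_ge0 ->]].
exists (fun i => if i \in s then c i else 0) => [i|m]; first by case: ifP.
rewrite mulmx_suml summxE [LHS]big_mkcond; apply: eq_bigr => i _.
by case: ifP; rewrite ?mul0r // -scalemxAl mxE -map_mxM mxE.
Qed.

Lemma pairing_inj : complete_fan X -> injective (pairing X).
Proof.
move=> Xcomplete m m' eq_mm'; apply/colP => k.
have [c _ cE] := rays_positively_span (delta_mx 0 k) Xcomplete.
have := cE m; rewrite eq_mm' -cE -!rowE !mxE => /eqP.
by rewrite eqr_int => /eqP.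
Qed.

Lemma finite_box (b : nat) :
  finite_set [set m : 'cV[int]_n | forall k, `|m k 0| <= b%:Z].
Proof.
pose f (x : {ffun 'I_n -> 'I_(b + b).+1}) : 'cV[int]_n := \col_k ((x k)%:Z - b%:Z).
apply: (@sub_finite_set _ _ (range f)); last exact: finite_image.
move=> m le_m; exists [ffun k => inord (absz (m k 0 + b%:Z))] => //.
apply/colP => k; rewrite mxE ffunE.
have := le_m k; rewrite ler_norml => /andP [le_b le_k].
have m_ge0 : 0 <= m k 0 + b%:Z by rewrite -lerBlDr sub0r.
have abs_m : (absz (m k 0 + b%:Z))%:Z = m k 0 + b%:Z by rewrite gez0_abs.
by rewrite inordK ?abs_m ?addrK // ltnS -lez_nat abs_m PoszD lerD2r.
Qed.

(** Each coordinate and its opposite are nonnegative combinations of the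
    pairings, which are bounded below on the polytope. *)
Lemma finite_polytope (D : 'rV[int]_r) : complete_fan X ->
  finite_set [set m | forall i, 0 <= pairing X m i + D 0 i].
Proof.
move=> Xcomplete.
have lower (v : 'rV[R]_n) : exists b : nat,
    forall m, (forall i, 0 <= pairing X m i + D 0 i) ->
    - b%:R <= (v *m map_mx intr m) 0 0.
  have [c c_ge0 cE] := rays_positively_span v Xcomplete.
  set x := \sum_i c i * (D 0 i)%:~R.
  exists (Num.bound `|x|) => m pos_m; rewrite cE.
  apply: (@le_trans _ _ (- x)).
    by rewrite lerN2 (le_trans (ler_norm x)) // ltW // archi_boundP.
  rewrite -subr_ge0 opprK -big_split /=; apply: sumr_ge0 => i _.
  by rewrite -mulrDr mulr_ge0 // -intrD ler0z.
(* The vectors e k and - e k bound the k-th coordinate on both sides. *)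
have /choice [lo loP] := lower; pose e k : 'rV[R]_n := delta_mx 0 k.
pose b := \max_k maxn (lo (e k)) (lo (- e k)).
apply: sub_finite_set (finite_box b) => m pos_m k.
have le_b : (maxn (lo (e k)) (lo (- e k)) <= b)%N by apply: leq_bigmax.
have := loP (e k) m pos_m; have := loP (- e k) m pos_m.
rewrite mulNmx mxE /e -rowE !mxE lerN2 => up dn.
rewrite ler_norml; apply/andP; split; rewrite -(@ler_int R) ?mulrNz.
  apply: le_trans dn; rewrite lerN2 ler_nat.
  exact: leq_trans (leq_maxl _ _) le_b.
apply: le_trans up _; rewrite ler_nat.
exact: leq_trans (leq_maxr _ _) le_b.
Qed.

End Geometry.

(** * Monomial ideals and saturation *)

Section MonomialIdeals.
Variables (R : realType) (n r : nat) (X : fan R n r).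
Notation cox := {mpoly (complex R)[r]}.

Lemma ideal_gen_sum (G : set cox) (T : Type) (xs : seq T) (F : T -> cox) :
  (forall x, ideal_gen G (F x)) -> ideal_gen G (\sum_(x <- xs) F x).
Proof.
move=> G_F; elim: xs => [|x xs [hs hs_G hsE]].
  by rewrite big_nil; exists [::]; rewrite ?big_nil.
have [gs gs_G gsE] := G_F x.
exists (gs ++ hs); last by rewrite big_cons big_cat gsE hsE.
by move=> g; rewrite mem_cat => /orP [/gs_G|/hs_G].
Qed.

Lemma ideal_genMl (G : set cox) f g : ideal_gen G g -> ideal_gen G (f * g).
Proof.
case=> gs gs_G ->; exists [seq (f * h.1, h.2) | h <- gs].
  by move=> _ /mapP [h /gs_G G_h ->].
by rewrite big_map mulr_sumr; apply: eq_bigr => h _; rewrite mulrA.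
Qed.

Lemma ideal_gen_monomialsP (E : set 'X_{1..r}) (f : cox) :
  ideal_gen [set f | exists2 e, E e & f = 'X_[e]] f <->
  forall mu, mu \in msupp f -> exists2 e, E e & (e <= mu)%MM.
Proof.
split=> [[gs gs_E ->] mu /msupp_sum_le /flattenP [xs /mapP [g]]|supp_f].
  rewrite filter_predT => g_gs -> {xs}.
  have [e E_e ->] := gs_E g g_gs.
  rewrite (perm_mem (msuppMX _ _)) => /mapP [nu _ ->].
  by exists e => //; apply: lem_addr.
rewrite [f]mpolyE big_seq_cond big_mkcond /=; apply: ideal_gen_sum => mu.
rewrite andbT; case: ifPn => [/supp_f [e E_e le_e]|_].
  exists [:: (f@_mu *: 'X_[(mu - e)], 'X_[e])]; last first.
    by rewrite big_seq1 -scalerAl -mpolyXD submK.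
  by move=> g; rewrite inE => /eqP ->; exists e.
by exists [::]; rewrite ?big_nil.
Qed.

Lemma mem_monomial_ideal (ms : seq 'X_{1..r}) (f : cox) :
  monomial_ideal R ms f <->
  forall mu, mu \in msupp f -> has (fun g => (g <= mu)%MM) ms.
Proof.
apply: iff_trans (ideal_gen_monomialsP [set` ms] f) _.
split=> supp_f mu mu_f; first by apply/hasP; exact: supp_f.
by have /hasP := supp_f mu mu_f.
Qed.

Lemma irrelevant_supp (f : cox) : irrelevant X f ->
  forall mu, mu \in msupp f ->
  exists2 s, s \in cones X & forall i, i \notin s -> (0 < mu i)%N.
Proof.
pose e (s : {set 'I_r}) : 'X_{1..r} := (\sum_(i | i \notin s) U_(i))%MM.
have XeE s : 'X_[e s] = \prod_(i | i \notin s) 'X_i :> cox.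
  by rewrite (big_morph (fun mu => 'X_[mu] : cox) (@mpolyXD _ _) (@mpolyX0 _ _)).
have -> : irrelevant X = ideal_gen
    [set f | exists2 x, (exists2 s, s \in cones X & x = e s) & f = 'X_[x]].
  congr ideal_gen; apply/funext => h; apply/propext; split.
    by move=> [s s_X ->]; exists (e s); [exists s|rewrite XeE].
  by move=> [_ [s s_X ->] ->]; exists s; rewrite // XeE.
move/ideal_gen_monomialsP => supp_f mu /supp_f [_ [s s_X ->] /mnm_lepP le_mu].
exists s => // i i_s; apply: leq_trans (le_mu i).
by rewrite mnm_sumE (bigD1 i) //= mnm1E eqxx.
Qed.

(** Each monomial of a product of elements of B is a multiple of a product of
    monomials x^(hat sigma), one for each factor; the list cs records the cones
    sigma chosen. *)
Lemma msupp_prod_irrelevant (T : Type) (xs : seq T) (b : T -> cox) :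
  (forall x, irrelevant X (b x)) ->
  forall mu, mu \in msupp (\prod_(x <- xs) b x) ->
  exists cs : seq {set 'I_r},
    [/\ size cs = size xs, {subset cs <= cones X}
      & forall i, (count (fun s : {set 'I_r} => i \notin s) cs <= mu i)%N].
Proof.
move=> irr_b; elim: xs => [|x xs IH] mu.
  by exists [::].
rewrite big_cons => /msuppM_le /allpairsP [[mu1 mu2] /= [in1 in2 ->]].
have [s s_X pos_s] := irrelevant_supp (irr_b x) in1.
have [cs [size_cs cs_X le_cs]] := IH mu2 in2.
exists (s :: cs); split=> /= [|s'|i]; first by rewrite size_cs.
  by rewrite inE => /orP [/eqP ->|/cs_X].
rewrite mnmDE leq_add //.
by have [//|/pos_s] := boolP (i \in s).
Qed.

Lemma pigeonhole (T : finType) (K : nat) (xs : seq T) :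
  (#|T| * K < size xs)%N -> exists x, (K < count_mem x xs)%N.
Proof.
move=> lt_xs; apply/existsP; apply: contraLR lt_xs => /existsPn le_K.
rewrite -leqNgt -sum1_size (partition_big id predT) //= -sum_nat_const.
by apply: leq_sum => x _; rewrite sum1_count leqNgt le_K.
Qed.

(** For a B-saturated I, divisibility by a generator can be checked on one
    maximal cone at a time.  With K a bound on the exponents of the generators
    and k > N * K for N sets of rays, some cone s is chosen more than K times in
    a monomial mu of a product of k elements of B, so mu_i > K for every i
    outside s.  Then the generator that is below e on a maximal cone containing
    s is below e + mu everywhere. *)
Lemma saturated_monomial_ideal (ms : seq 'X_{1..r}) (e : 'X_{1..r}) :
  B_saturated X (monomial_ideal R ms) ->
  (forall s, s \in max_cones X ->
    has (fun g : 'X_{1..r} => [forall i in s, (g i <= e i)%N]) ms) ->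
  has (fun g => (g <= e)%MM) ms.
Proof.
move=> Isat loc_e.
suff /mem_monomial_ideal : monomial_ideal R ms 'X_[e].
  by apply; rewrite msuppX inE.
pose K := \max_(g <- ms) mdeg g.
have le_K g i : g \in ms -> (g i <= K)%N.
  move=> g_ms; apply: leq_trans (leq_bigmax_seq _ g_ms isT).
  by rewrite mdegE (bigD1 i) //= leq_addr.
pose k := (#|{: {set 'I_r}}| * K).+1.
rewrite Isat; exists k => // h [gs gs_B ->].
rewrite mulr_sumr big_seq_cond big_mkcond /=; apply: ideal_gen_sum => g.
rewrite andbT; case: ifPn => [/gs_B [b irr_b ->]|_]; last first.
  by exists [::]; rewrite ?big_nil.
rewrite mulrCA; apply/ideal_genMl/mem_monomial_ideal => nu.
rewrite mulrC (perm_mem (msuppMX _ _)) => /mapP [mu mu_b ->].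
have [cs [size_cs cs_X le_cs]] := msupp_prod_irrelevant irr_b mu_b.
have [|s lt_s] := @pigeonhole _ K cs.
  by rewrite size_cs -[index_enum _]enumT size_enum_ord.
have s_cs : s \in cs by rewrite -has_pred1 has_count (leq_ltn_trans _ lt_s).
have [s' s'_max sub_s] := sub_max_cone (cs_X s s_cs).
have /hasP [g' g'_ms /forall_inP le_g'] := loc_e s' s'_max.
apply/hasP; exists g' => //; apply/mnm_lepP => i; rewrite mnmDE.
have [i_s'|i_s'] := boolP (i \in s'); first by rewrite (leq_trans (le_g' i i_s')) ?leq_addl ?leq_addr.
suff : (g' i <= mu i)%N by move/leq_trans; apply; rewrite ?leq_addl ?leq_addr.
apply: leq_trans (le_K _ i g'_ms) _; apply: leq_trans (ltnW lt_s) _.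
apply: leq_trans (le_cs i); apply: sub_count => _ /eqP ->.
by apply: contra i_s'; apply: (fintype.subsetP sub_s).
Qed.


(** The change-of-basis matrices A and A' satisfy A *m A' = 1, because the
    classes of the b j are independent, and this bounds the number of rows of A
    by the number of its columns. *)
Lemma quotient_dim_unique (W : set cox) (ms : seq 'X_{1..r}) d d' :
  quotient_dim W (monomial_ideal R ms) d ->
  quotient_dim W (monomial_ideal R ms) d' -> d = d'.
Proof.
suff le_dim k k' : quotient_dim W (monomial_ideal R ms) k ->
    quotient_dim W (monomial_ideal R ms) k' -> (k <= k')%N.
  by move=> dim_d dim_d'; apply/eqP; rewrite eqn_leq !le_dim.
move=> [b [W_b free_b span_b]] [b' [W_b' _ span_b']].
have /choice [A AP] : forall j, exists c : 'I_k' -> complex R,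
    monomial_ideal R ms (b j - \sum_l c l *: b' l) by move=> j; apply: span_b'.
have /choice [A' A'P] : forall l, exists c : 'I_k -> complex R,
    monomial_ideal R ms (b' l - \sum_j c j *: b j) by move=> l; apply: span_b.
apply: (@mulmx1_min _ _ _ (\matrix_(j, l) A j l) (\matrix_(l, j) A' l j)).
apply/matrixP => j0 j; apply/eqP; rewrite eq_sym -subr_eq0; apply/eqP.
rewrite !mxE -[LHS]/((fun j => _) j).
apply: (free_b (fun j => (j0 == j)%:R -
  \sum_l (\matrix_(j, l) A j l) j0 l * (\matrix_(l, j) A' l j) l j)).
(* Row j0 of 1 - A *m A' is the coefficient vector of a combination of the
   b j that lies in the ideal: b j0 is rewritten by the b' l, and these by the
   b j, and the family t collects the resulting members of the ideal. *)
pose t (u : 'I_k'.+1) : cox := if unlift ord0 u is Some l then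
    (A j0 l)%:MP * (b' l - \sum_j A' l j *: b j)
  else b j0 - \sum_l A j0 l *: b' l.
suff -> : \sum_j1 ((j0 == j1)%:R - \sum_l (\matrix_(j, l) A j l) j0 l *
    (\matrix_(l, j) A' l j) l j1) *: b j1 = \sum_u t u.
  apply: ideal_gen_sum => u; rewrite /t; case: unlift => [l|]; last exact: AP.
  exact/ideal_genMl/A'P.
rewrite big_ord_recl /t unlift_none.
under [X in _ = _ + X]eq_bigr => l _ do
  rewrite liftK mul_mpolyC scalerBr scaler_sumr.
rewrite sumrB addrA subrK exchange_big /=.
under eq_bigr => j1 _ do rewrite scalerBl.
rewrite sumrB (bigD1 j0) //= eqxx scale1r big1 ?addr0; last first.
  by move=> j1 /negPf ne_j; rewrite eq_sym ne_j scale0r.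
congr (_ - _); apply: eq_bigr => j1 _; rewrite scaler_suml.
by apply: eq_bigr => l _; rewrite !mxE scalerA.
Qed.

(** Membership in a monomial ideal is decided on the support, so a polynomial is
    determined modulo the ideal by its coefficients at the standard monomials. *)
Lemma standard_monomials_basis (ms es : seq 'X_{1..r}) (alpha : Cl X) :
  uniq es ->
  (forall e, e \in es <->
     monomial_class X e = alpha /\ ~~ has (fun g => (g <= e)%MM) ms) ->
  quotient_dim (graded_piece alpha) (monomial_ideal R ms) (size es).
Proof.
move=> es_uniq esE; pose e (j : 'I_(size es)) := nth 0%MM es j.
have e_es j : e j \in es by apply: mem_nth.
have coeff_e (c : 'I_(size es) -> complex R) j : (\sum_l c l *: 'X_[e l] : cox)@_(e j) = c j.
  rewrite raddf_sum (bigD1 j) //= mcoeffZ mcoeffX eqxx mulr1 big1 ?addr0 //.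
  move=> l ne_l; rewrite mcoeffZ mcoeffX /e nth_uniq //.
  by rewrite -[(l : nat) == j]/(l == j) (negPf ne_l) mulr0.
exists (fun j => 'X_[e j]); split=> [j mu|c /mem_monomial_ideal I_c j|f W_f].
- rewrite msuppX inE => /eqP ->.
  by have [] := (esE (e j)).1 (e_es j).
- apply/eqP; rewrite -(coeff_e c) mcoeff_eq0; apply/negP => /I_c.
  by have [_ /negP] := (esE (e j)).1 (e_es j).
exists (fun j => f@_(e j)); apply/mem_monomial_ideal => mu.
rewrite mcoeff_msupp mcoeffB; apply: contraNT => no_g.
have [mu_es|mu_es] := boolP (mu \in es).
  have lt_mu : (index mu es < size es)%N by rewrite index_mem.
  have := coeff_e (fun j => f@_(e j)) (Ordinal lt_mu).
  by rewrite /e /= nth_index // => ->; rewrite subrr.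
rewrite raddf_sum big1 /= ?subr0 => [|l _]; last first.
  rewrite mcoeffZ mcoeffX; case: eqP => [e_l|]; rewrite ?mulr0 //.
  by rewrite -e_l e_es in mu_es.
rewrite mcoeff_eq0; apply: contra mu_es => /W_f mu_alpha.
by apply/esE.
Qed.

End MonomialIdeals.

(** * The grading by the class group *)

Section Grading.
Variables (R : realType) (n r : nat) (X : fan R n r).

Lemma divisor_class_is_zmod_morphism : zmod_morphism (divisor_class X).
Proof.
move=> D E; rewrite /divisor_class.
exact: (raddfB (\pi_(Quotient.quot (principal X)))%qT).
Qed.

HB.instance Definition _ := GRing.isZmodMorphism.Build
  'rV[int]_r (Cl X) (divisor_class X) divisor_class_is_zmod_morphism.

Lemma divisor_class_eq (D E : 'rV[int]_r) :
  divisor_class X D = divisor_class X E <->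
  exists m, D = divisor_of_char X m + E.
Proof.
have -> : divisor_class X D = divisor_class X E <-> D - E \in principal X.
  by rewrite Quotient.idealrBE; split=> /eqP.
rewrite unfold_in /=; split=> [/asboolP [m mE]|[m ->]].
  by exists m; rewrite -mE subrK.
by apply/asboolP; exists m; rewrite addrK.
Qed.

Lemma monomial_classE (mu : 'X_{1..r}) :
  monomial_class X mu = divisor_class X (\row_i (mu i)%:Z).
Proof.
rewrite [\row_i _]row_sum_delta raddf_sum; apply: eq_bigr => i _.
by rewrite mxE /ray_class -raddfMn /= -scaler_nat natz.
Qed.

Lemma class_of_coordsE (l : nat) (hl : (l <= r)%N) (a : 'rV[int]_l) :
  class_of_coords X hl a = divisor_class X (bar hl a).
Proof.
rewrite raddf_sum; apply: eq_bigr => i _.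
by rewrite /ray_class -raddfMz /= -scaler_int intz.
Qed.

(** The absolute value only serves to land in the natural numbers: [exponent] is
    meant for characters of the polytope of D, where the entries are
    nonnegative. *)
Definition exponent (D : 'rV[int]_r) (m : 'cV[int]_n) : 'X_{1..r} :=
  [multinom `|(pairing X m i + D 0 i)%R|%N | i < r].

Lemma exponentE (D : 'rV[int]_r) m : (forall i, 0 <= pairing X m i + D 0 i) ->
  forall i, (exponent D m i)%:Z = pairing X m i + D 0 i.
Proof. by move=> pos_m i; rewrite mnmE gez0_abs. Qed.

Lemma exponent_inj (D : 'rV[int]_r) : complete_fan X ->
  {in [set m | forall i, 0 <= pairing X m i + D 0 i] &, injective (exponent D)}.
Proof.
move=> Xcomplete m m' /set_mem pos_m /set_mem pos_m' eq_e.
apply: (pairing_inj Xcomplete); apply/funext => i.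
by apply: (addIr (D 0 i)); rewrite -!exponentE // eq_e.
Qed.

(** A divisor linearly equivalent to D is D + div(chi^m); it is the divisor of a
    monomial when it is effective, which puts m in the polytope of D. *)
Lemma monomial_class_exponent (D : 'rV[int]_r) (mu : 'X_{1..r}) :
  monomial_class X mu = divisor_class X D <->
  exists2 m, forall i, 0 <= pairing X m i + D 0 i & mu = exponent D m.
Proof.
rewrite monomial_classE divisor_class_eq; split=> [[m muE]|[m pos_m ->]]; exists m.
- by move=> i; have /rowP/(_ i) := muE; rewrite !mxE => <-.
- apply/mnmP => i; rewrite mnmE.
  by have /rowP/(_ i) := muE; rewrite !mxE => <-.
- by apply/rowP => i; rewrite !mxE exponentE.
Qed.

End Grading.

(** * Counting standard monomials *)

(** By [in_C_or_Delta] after translation by tau, the term of s consists of the m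
    for which no generator is below the exponent on s; [saturated_monomial_ideal]
    then passes from all the maximal cones to all the rays. *)
Lemma diagram_union_standard (R : realType) (n r : nat) (X : fan R n r)
    (ms : seq 'X_{1..r}) (D : 'rV[int]_r) :
  smooth_fan X -> B_saturated X (monomial_ideal R ms) ->
  \bigcup_(s in max_cones X)
      ((shift X D s (Delta_diag X ms s) `&` C_zero_shift X D)
       `|` (C_zero_shift X D `\` shift X D s (C_diag X ms s))) =
  [set m | (forall i, 0 <= pairing X m i + D 0 i) /\
           ~~ has (fun g => (g <= exponent X D m)%MM) ms].
Proof.
move=> Xsmooth Isat.
have localE m s : s \in max_cones X -> (forall i, 0 <= pairing X m i + D 0 i) ->
    (shift X D s (Delta_diag X ms s) m \/ ~ shift X D s (C_diag X ms s) m) <->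
    ~~ has (fun g : 'X_{1..r} => [forall i in s, (g i <= exponent X D m i)%N]) ms.
  move=> s_max pos_m; rewrite /shift /= in_C_or_Delta.
  suff -> : has (fun g : 'X_{1..r} =>
        [forall i in s, (g i)%:Z <= pairing X (m + tau X D s) i]) ms
      = has (fun g : 'X_{1..r} => [forall i in s, (g i <= exponent X D m i)%N]) ms.
    by [].
  apply: eq_has => g; apply: eq_forallb_in => i i_s.
  by rewrite pairingD tau_spec ?max_cone_cones // -exponentE.
apply/seteqP; split=> [m [s /mem_set s_max m_s]|m [pos_m no_g]].
  have [/(C_zero_shiftE _ _ Xsmooth) pos_m loc_m] : C_zero_shift X D m /\
      (shift X D s (Delta_diag X ms s) m \/ ~ shift X D s (C_diag X ms s) m).
    by case: m_s => [[]|[]]; tauto.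
  split=> //; move/(localE _ _ s_max pos_m): loc_m; apply: contra.
  move=> /hasP [g g_ms /mnm_lepP le_g]; apply/hasP; exists g => //.
  by apply/forall_inP => i _.
have [s s_max no_g_s] : exists2 s, s \in max_cones X &
    ~~ has (fun g : 'X_{1..r} => [forall i in s, (g i <= exponent X D m i)%N]) ms.
  apply: contrapT => no_s; move/negP: no_g; apply.
  apply: (saturated_monomial_ideal Isat) => s s_max.
  by apply: contrapT => /negP no_g; apply: no_s; exists s.
exists s; first exact: set_mem.
have C_m := (C_zero_shiftE D m Xsmooth).2 pos_m.
by case: ((localE _ _ s_max pos_m).2 no_g_s); [left|right].
Qed.

Theorem proposition4p1 (R : realType) (n r : nat) (X : fan R n r)
    (Xsmooth : smooth_fan X) (Xcomplete : complete_fan X)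
    (l : nat) (hl : (l <= r)%N) (Xbasis : class_basis X hl)
    (ms : seq 'X_{1..r}) (ms_neq0 : ms != [::])
    (Isat : B_saturated X (monomial_ideal R ms))
    (alpha : Cl X) (a : 'rV[int]_l) (alphaE : alpha = class_of_coords X hl a) :
  (exists d, quotient_dim (graded_piece alpha) (monomial_ideal R ms) d) /\
  (\bigcup_(s in max_cones X)
      ((shift X (bar hl a) s (Delta_diag X ms s) `&` C_zero_shift X (bar hl a))
       `|` (C_zero_shift X (bar hl a)
              `\` shift X (bar hl a) s (C_diag X ms s)))
   #= `I_(hilbert (monomial_ideal R ms) alpha))%card.
Proof.
rewrite (diagram_union_standard _ Xsmooth Isat).
set D := bar hl a; set std := [set m | _].
have std_pos : std `<=` [set m | forall i, 0 <= pairing X m i + D 0 i] by move=> m [].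
have std_fin : finite_set std := sub_finite_set std_pos (finite_polytope D Xcomplete).
have /finite_setP [d std_card] := std_fin.
suff dim_d : quotient_dim (graded_piece alpha) (monomial_ideal R ms) d.
  split; first by exists d.
  rewrite /hilbert (xget_unique 0%N dim_d) // => d' dim_d'.
  exact: quotient_dim_unique dim_d' dim_d.
pose pts : seq 'cV[int]_n := finmap.enum_fset (fset_set std).
have ptsE m : (m \in pts) = (m \in std) by rewrite -in_fset_set.
rewrite -(card_fset_set std_card) -/pts -(size_map (exponent X D)).
apply: standard_monomials_basis => [|e].
  rewrite map_inj_in_uniq ?finmap.fset_uniq // => m m'.
  rewrite !ptsE => /set_mem/std_pos pos_m /set_mem/std_pos pos_m'.
  by apply: exponent_inj; rewrite ?inE.
rewrite alphaE class_of_coordsE monomial_class_exponent.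
split=> [/mapP [m]|[[m pos_m ->] no_g]].
  by rewrite ptsE => /set_mem [pos_m no_g] ->; split=> //; exists m.
by apply: map_f; rewrite ptsE; apply/mem_set.
Qed.
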